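(* Let $X,Y$ be bounded metric spaces, and let $m$ and $n$ be cardinal numbers such that $1<n\le\#X$ and $1<m\le\#Y$. Suppose that the metric segment $[X,Y]$ is extreme, i.e. $2d_{GH}(X,Y)=\operatorname{diam}X=\operatorname{diam}Y>0$, and that the following conditions hold: (1) there exists a partition $D_X$ of $X$ into $n$ non-empty subsets such that $\alpha(D_X)>0$; (2) there exists a covering $C_Y$ of $Y$ by $m$ non-empty subsets such that $\operatorname{diam}C_Y<\operatorname{diam}Y$; (3) $m\le n$. Then the metric segment $[X,Y]$ cannot be extended beyond $Y$, i.e. there is no metric space $Z$ with $d_{GH}(Y,Z)>0$, $d_{GH}(X,Z)<\infty$ and $d_{GH}(X,Z)=d_{GH}(X,Y)+d_{GH}(Y,Z)$.
   Context: All metric spaces are non-empty, with finite distances. $d_{GH}$ is the Gromov--Hausdorff distance, $d_{GH}(X,Y)=\frac12\inf\operatorname{dis}R$ over all correspondences $R\subset X\times Y$ (subsets projecting surjectively onto both factors), where $\operatorname{dis}R=\sup\{\bigl||xx'|-|yy'|\bigr|:(x,y),(x',y')\in R\}$. $\#X$ is the cardinality of $X$. The metric segment $[X,Y]$ (defined when $d_{GH}(X,Y)<\infty$) is the class of all metric spaces $W$ with $d_{GH}(X,W)+d_{GH}(W,Y)=d_{GH}(X,Y)$. For a family $D=\{X_i\}_{i\in I}$ of non-empty subsets of a metric space, $\operatorname{diam}D=\sup_{i\in I}\operatorname{diam}X_i$ and $\alpha(D)=\inf\{|X_iX_j|:i\ne j\}$, where $|AB|=\inf\{|ab|:a\in A,\,b\in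 B\}$. A partition is a covering by pairwise disjoint non-empty subsets. *)

(* Defs.v *)
From HB Require Import structures.
From mathcomp Require Import all_boot all_order all_algebra.
From mathcomp Require Import all_classical all_reals all_analysis.

Set Implicit Arguments.
Unset Strict Implicit.
Unset Printing Implicit Defensive.

Import Order.TTheory GRing.Theory Num.Theory.

Local Open Scope classical_set_scope.
Local Open Scope ring_scope.
Local Open Scope card_scope.
Local Open Scope ereal_scope.

(* A [metricType R] may be empty; non-emptiness is stated where it is needed.
   Diameters, distances between subsets, distortions and Gromov--Hausdorff
   distances may be infinite, hence take values in [\bar R]. *)

Section metric_notions.
Context {R : realType}.

Definition bounded_space (X : metricType R) : Prop :=
  exists M : R, forall x x' : X, (mdist x x' <= M)%R.

Definition diam (X : metricType R) (A : set X) : \bar R :=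
  ereal_sup [set (mdist a a')%:E | a in A & a' in A].

Definition set_dist (X : metricType R) (A B : set X) : \bar R :=
  ereal_inf [set (mdist a b)%:E | a in A & b in B].

Definition family_diam (X : metricType R) (I : Type) (D : I -> set X)
    : \bar R :=
  ereal_sup [set diam (D i) | i in [set: I]].

Definition alpha (X : metricType R) (I : Type) (D : I -> set X) : \bar R :=
  ereal_inf [set set_dist (D p.1) (D p.2) | p in [set p : I * I | p.1 <> p.2]].

Definition correspondence (X Y : metricType R) (C : set (X * Y)) : Prop :=
  (forall x, exists y, C (x, y)) /\ (forall y, exists x, C (x, y)).

Definition distortion (X Y : metricType R) (C : set (X * Y)) : \bar R :=
  ereal_sup
    [set (`|mdist p.1 q.1 - mdist p.2 q.2|%R)%:E | p in C & q in C].

Definition gh_dist (X Y : metricType R) : \bar R :=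
  (2^-1)%:E * ereal_inf [set distortion C | C in @correspondence X Y].

Definition extreme_segment (X Y : metricType R) : Prop :=
  [/\ 2%:E * gh_dist X Y = diam [set: X],
      diam [set: X] = diam [set: Y] & 0 < diam [set: Y]].

Definition extendable_beyond (X Y : metricType R) : Prop :=
  exists Z : metricType R,
    [/\ [set: Z] !=set0, 0 < gh_dist Y Z, gh_dist X Z < +oo &
        gh_dist X Z = gh_dist X Y + gh_dist Y Z].

End metric_notions.

Definition card_lt (T U : Type) (A : set T) (B : set U) : Prop :=
  A #<= B /\ ~ (B #<= A).

(* Main.v *)
Require Import Defs.
From HB Require Import structures.
From mathcomp Require Import all_boot all_order all_algebra.
From mathcomp Require Import all_classical all_reals all_analysis.
From mathcomp Require Import lra.

(* Let d = diam X = diam Y, so that d_GH(X, Z) = d/2 + r with r = d_GH(Y, Z).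
   Transport the covering of Y to Z through a correspondence of distortion
   less than 2r + e: distances in Z are less than d + 2r + e, and those inside
   a transported piece are less than c + 2r + e, where c = diam C_Y < d.  As
   m <= n, the blocks of D_X can be matched with these m pieces, every piece
   being used.  Matched pairs give a correspondence between X and Z whose
   distortion is at most the maximum of d, c + 2r + e and
   d + 2r + e - alpha(D_X), which is less than d + 2r = 2 d_GH(X, Z) for small
   e: a contradiction. *)

Set Implicit Arguments.
Unset Strict Implicit.
Unset Printing Implicit Defensive.

Import Order.TTheory GRing.Theory Num.Theory.

Local Open Scope classical_set_scope.
Local Open Scope ring_scope.
Local Open Scope card_scope.
Local Open Scope ereal_scope.

(** An injection of [J] into [I] has a left inverse; an element of [J] serves as its value off the
    image. *)
Lemma card_le_surjective (J I : Type) : [set: J] !=set0 ->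
  [set: J] #<= [set: I] -> exists g : I -> J, forall j, exists i, g i = j.
Proof.
elim/Ppointed: J => [J [j]|J _ /pcard_surjP[g gsurj]]; first by case: (no j).
by exists g => j; have [i _ <-] := gsurj j Logic.I; exists i.
Qed.

Section real_bounds.
Context {R : realType}.

(** This and the next lemma replace strict inequalities in [\bar R] by real ones fit for [lra]; the
    extended value may be infinite. *)
Lemma lt_fin_ub (x : \bar R) (y : R) :
  x < y%:E -> exists2 r, (r < y)%R & x <= r%:E.
Proof.
case: x => [r|//|_]; first by rewrite lte_fin => ry; exists r.
by exists (y - 1)%R; [lra | exact: leNye].
Qed.

Lemma gt_fin_lb (x : \bar R) (y : R) :
  y%:E < x -> exists2 r, (y < r)%R & r%:E <= x.
Proof.
case: x => [r|_|//]; first by rewrite lte_fin => ry; exists r.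
by exists (y + 1)%R; [lra | exact: leey].
Qed.

Lemma mdist_le_diam (X : metricType R) (A : set X) a a' (c : R) :
  diam A <= c%:E -> A a -> A a' -> (mdist a a' <= c)%R.
Proof.
move=> /ereal_supP Ac Aa Aa'; rewrite -lee_fin; apply: Ac.
by exists a => //; exists a'.
Qed.

Lemma diam_le_family_diam (X : metricType R) (I : Type) (D : I -> set X) i :
  diam (D i) <= family_diam D.
Proof. by apply: ereal_sup_ubound; exists i. Qed.

Lemma mdist_ge_alpha (X : metricType R) (I : Type) (D : I -> set X) i j x y
    (c : R) :
  c%:E <= alpha D -> i <> j -> D i x -> D j y -> (c <= mdist x y)%R.
Proof.
move=> cD ij Dx Dy; rewrite -lee_fin (le_trans cD)//.
apply: (@le_trans _ _ (set_dist (D i) (D j))).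
  by apply: ereal_inf_lbound; exists (i, j).
by apply: ereal_inf_lbound; exists x => //; exists y.
Qed.

(** Boundedness excludes [+oo], and positivity excludes [-oo], the supremum of the empty set. *)
Lemma diam_fin_num (X : metricType R) :
  bounded_space X -> 0 < diam [set: X] -> diam [set: X] \is a fin_num.
Proof.
move=> [M XM] X0; rewrite ge0_fin_numE ?ltW//.
apply: (@le_lt_trans _ _ M%:E); last exact: ltry.
by apply/ereal_supP => _ [x _ [x' _ <-]]; rewrite lee_fin.
Qed.

Lemma gh_dist_le (X Y : metricType R) (C : set (X * Y)) (c : R) :
  correspondence C ->
  (forall p q, C p -> C q ->
     (`|mdist p.1 q.1 - mdist p.2 q.2| <= c)%R) ->
  gh_dist X Y <= (c / 2)%:E.
Proof.
move=> Ccorr Cc; rewrite mulrC EFinM lee_pmul2l// ?lte_fin ?invr_gt0//.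
apply: (@le_trans _ _ (distortion C)).
  by apply: ereal_inf_lbound; exists C.
by apply/ereal_supP => _ [p Cp [q Cq <-]]; rewrite lee_fin; exact: Cc.
Qed.

Lemma gh_dist_lt (X Y : metricType R) (c : R) : gh_dist X Y < (c / 2)%:E ->
  exists2 C : set (X * Y), correspondence C &
    forall p q, C p -> C q -> (`|mdist p.1 q.1 - mdist p.2 q.2| < c)%R.
Proof.
rewrite mulrC EFinM lte_pmul2l// ?lte_fin ?invr_gt0//.
move=> /ereal_inf_lt[_ [C Ccorr <-] Cc]; exists C => // p q Cp Cq.
rewrite -lte_fin; apply: le_lt_trans Cc; apply: ereal_sup_ubound.
by exists p => //; exists q.
Qed.

(** Over a single block the two distances lie in [0, d] and [0, c]; over distinct blocks they lie in
    [a, d] and [0, b]. Hence they differ by at most max(d, c), respectively max(d, b - a). *)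
Lemma gh_dist_partition_covering (X Z : metricType R) (I J : Type)
    (D : I -> set X) (E : J -> set Z) (d a b c B : R) :
  cover [set: I] D = [set: X] -> (forall i, D i !=set0) ->
  cover [set: J] E = [set: Z] -> (forall j, E j !=set0) ->
  [set: J] !=set0 -> [set: J] #<= [set: I] ->
  a%:E <= alpha D ->
  (forall x x' : X, mdist x x' <= d)%R ->
  (forall z z' : Z, mdist z z' <= b)%R ->
  (forall j z z', E j z -> E j z' -> mdist z z' <= c)%R ->
  (d <= B)%R -> (b - a <= B)%R -> (c <= B)%R ->
  gh_dist X Z <= (B / 2)%:E.
Proof.
move=> DX Dn0 EZ En0 J0 JI aD Xd Zb Ec dB baB cB.
have [g gsurj] := card_le_surjective J0 JI.
(* Each block is related in full to its piece; surjectivity of [g] is what makes [C] reach all of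
   [Z]. *)
pose C := [set p : X * Z | exists2 i, D i p.1 & E (g i) p.2].
apply: (@gh_dist_le _ _ C).
  split=> [x|z].
    have : cover [set: I] D x by rewrite DX.
    by move=> [i _ Dx]; have [z Ez] := En0 (g i); exists z, i.
  have : cover [set: J] E z by rewrite EZ.
  move=> [j _]; have [i <-] := gsurj j => Ez.
  by have [x Dx] := Dn0 i; exists x, i.
move=> [x z] [x' z'] [i /= Dx Ez] [i' /= Dx' Ez'].
have := mdist_ge0 x x'; have := mdist_ge0 z z'; have := Xd x x'.
rewrite ler_norml; have [ii'|ii'] := pselect (i = i').
  have := Ec (g i) z z' Ez; rewrite ii' => /(_ Ez'); lra.
have := mdist_ge_alpha aD ii' Dx Dx'; have := Zb z z'; lra.
Qed.

End real_bounds.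

(* The cardinal numbers n and m are those of the index types I and J. *)
Theorem theorem3p19 (R : realType) (X Y : metricType R)
    (X_nonempty : [set: X] !=set0) (Y_nonempty : [set: Y] !=set0)
    (X_bounded : bounded_space X) (Y_bounded : bounded_space Y)
    (I J : Type)
    (n_gt1 : card_lt [set: unit] [set: I]) (n_leX : [set: I] #<= [set: X])
    (m_gt1 : card_lt [set: unit] [set: J]) (m_leY : [set: J] #<= [set: Y])
    (XY_extreme : extreme_segment X Y)
    (X_partition : exists D : I -> set X,
        partition [set: I] D [set: X] /\ 0 < alpha D)
    (Y_covering : exists C : J -> set Y,
        [/\ cover [set: J] C = [set: Y], forall j, C j !=set0 &
            family_diam C < diam [set: Y]])
    (m_le_n : [set: J] #<= [set: I]) :
  ~ extendable_beyond X Y.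
Proof.
have [XYdiam diamXY Y0] := XY_extreme.
have [D [[DX _ Dn0] /gt_fin_lb[a a0 aD]]] := X_partition.
have [C [CY Cn0]] := Y_covering.
pose d := fine (diam [set: Y]).
have dE : diam [set: Y] = d%:E by rewrite fineK// diam_fin_num.
have XY2 : gh_dist X Y = (d / 2)%:E.
  rewrite mulrC EFinM -dE -diamXY -XYdiam muleA -EFinM mulVf//.
  by rewrite mul1e.
rewrite dE => /lt_fin_ub[c cd Cc].
have Xd (x x' : X) : (mdist x x' <= d)%R.
  by apply: (@mdist_le_diam _ _ [set: X]); rewrite ?diamXY ?dE.
have Yd (y y' : Y) : (mdist y y' <= d)%R.
  by apply: (@mdist_le_diam _ _ [set: Y]); rewrite ?dE.
have J0 : [set: J] !=set0.
  have [y _] := Y_nonempty; have : cover [set: J] C y by rewrite CY.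
  by move=> [j _ _]; exists j.
move=> [Z [_ YZ0 XZoo XZE]].
(* An infinite distance from [Y] to [Z] would make the sum [XZE] infinite, against [XZoo]. *)
have YZfin : gh_dist Y Z \is a fin_num.
  by rewrite ge0_fin_numE ?ltW//; move: XZoo; rewrite XZE XY2; case: gh_dist => //= *; rewrite ltry.
move: YZ0 XZE; rewrite -(fineK YZfin) XY2 -EFinD; set r := fine _.
rewrite lte_fin => r0 XZE.
(* The target is B = d + 2r - e, whose half lies strictly below d/2 + r. The three entries of the
   minimum give (d + 2r + e) - a <= B, c + 2r + e <= B and d <= B, in this order. *)
pose e := (Num.min a (Num.min (d - c) (4 * r)) / 2)%R.
have [e0 ea edc er] :
    [/\ (0 < e)%R, (2 * e <= a)%R, (2 * e <= d - c)%R & (2 * e <= 4 * r)%R].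
  have e2 : (2 * e = Num.min a (Num.min (d - c) (4 * r)))%R.
    by rewrite /e mulrC divfK.
  have m0 : (0 < 2 * e)%R by rewrite e2 !lt_min a0; apply/andP; lra.
  by split; [lra|rewrite e2 !ge_min lexx ?orbT..].
have [S [SY SZ] Sdis] : exists2 S : set (Y * Z), correspondence S &
    forall p q, S p -> S q ->
      (`|mdist p.1 q.1 - mdist p.2 q.2| < 2 * r + e)%R.
  by apply: gh_dist_lt; rewrite -(fineK YZfin) lte_fin -/r; lra.
(* These images under [S] may overlap; they only have to cover [Z]. *)
pose E j := [set z : Z | exists2 y, C j y & S (y, z)].
have : gh_dist X Z <= ((d + 2 * r - e) / 2)%:E.
  apply: (@gh_dist_partition_covering _ _ _ I J D E d a (d + 2 * r + e)
    (c + 2 * r + e)) => //; last 3 first.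
  - lra.
  - lra.
  - lra.
  - by move=> i; exact: Dn0.
  - apply/seteqP; split=> // z _; have [y Syz] := SZ z.
    have : cover [set: J] C y by rewrite CY.
    by move=> [j _ Cy]; exists j => //; exists y.
  - by move=> j; have [y Cy] := Cn0 j; have [z Syz] := SY y; exists z, y.
  - move=> z z'; have [y Syz] := SZ z; have [y' Syz'] := SZ z'.
    by have := Sdis _ _ Syz Syz'; have := Yd y y'; rewrite ltr_norml/=; lra.
  - move=> j z z' [y Cy Syz] [y' Cy' Syz'].
    have := Sdis _ _ Syz Syz'; rewrite ltr_norml/=.
    have := mdist_le_diam (le_trans (diam_le_family_diam C j) Cc) Cy Cy'; lra.
by rewrite XZE lee_fin; lra.
Qed.
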